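(* Let $I=(I_-,I_+)\subset\mathbb R$ be a nonempty open interval with closure $\overline I=[I_-,I_+]\subset[-\infty,\infty]$, and let $\lambda_\pm:\overline I\to[0,\infty)$ be continuous functions such that $\lambda_-$ is nonincreasing, $\lambda_+$ is nondecreasing, $\lambda_-,\lambda_+>0$ on $I$, and $V_{\rm W}<V_{\rm max}$. Let $V\in(V_{\rm W},V_{\rm max}]$, assume that $J=(J_-,J_+):=\big(\lambda_-^{-1}(V),\lambda_+^{-1}(V)\big)$ satisfies $\overline J\subset I$, and let $(f_-,f_+)$ be the unique solution to Luckock's equation on $J$. Then: (i) If $\Phi(V)<V_{\rm W}^{-2}$, then $f_-(J_-)>0$ and $f_+(J_+)>0$. (ii) If $\Phi(V)=V_{\rm W}^{-2}$, then $f_-(J_-)=0$ and $f_+(J_+)=0$. (iii) If $\Phi(V)>V_{\rm W}^{-2}$, then $f_-(J_-)<0$ and $f_+(J_+)<0$.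
   Context: $V_{\rm max}:=\lambda_-(I_-)\wedge\lambda_+(I_+)$ and $V_{\rm W}:=\sup_{x\in\overline I}\lambda_-(x)\wedge\lambda_+(x)$. The functions $\lambda_-^{-1}:[\lambda_-(I_+),\lambda_-(I_-)]\to\overline I$ and $\lambda_+^{-1}:[\lambda_+(I_-),\lambda_+(I_+)]\to\overline I$ are defined by $$\lambda_-^{-1}(V):=\sup\{x\in\overline I:\lambda_-(x)\ge V\},\qquad \lambda_+^{-1}(V):=\inf\{x\in\overline I:\lambda_+(x)\ge V\}.$$ The function $\Phi:[V_{\rm W},V_{\rm max}]\to[0,\infty]$ is $$\Phi(V):=-\int_{V_{\rm W}}^V\Big\{\frac{1}{\lambda_+(\lambda_-^{-1}(W))}+\frac{1}{\lambda_-(\lambda_+^{-1}(W))}\Big\}\,\mathrm d\Big(\frac1W\Big).$$ **Luckock's equation on $J$.** For an interval $J=(J_-,J_+)$ with $\overline J=[J_-,J_+]\subset I$, a solution to Luckock's equation on $J$ is a pair $(f_-,f_+)$ of continuous functions of bounded variation on $\overline J$ such that $f_-\,\mathrm d\lambda_++\lambda_-\,\mathrm df_+=0$ and $f_+\,\mathrm d\lambda_-+\lambda_+\,\mathrm df_-=0$ as signed measures on $\overline J$, and $f_-(J_+)=1=f_+(J_-)$. Here $\mathrm df$ is the atomless signed measure with $\mathrm df((x,y])=f(y)-f(x)$ and $g\,\mathrm df$ is $\mathrm df$ weighted with density $g$. Since $\lambda_\pm$ are strictly positive on $\overline J$, it is a fact that there is exactly one solution. *)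

(* Defs.v *)
From HB Require Import structures.
From mathcomp Require Import all_boot all_order all_algebra.
From mathcomp Require Import all_classical all_reals all_analysis.
From mathcomp Require Import lra.

Set Implicit Arguments.
Unset Strict Implicit.
Unset Printing Implicit Defensive.

Import Order.TTheory GRing.Theory Num.Theory.
Import numFieldNormedType.Exports.

Local Open Scope classical_set_scope.
Local Open Scope ring_scope.

Section signed_stieltjes.
Context {R : realType}.
Local Notation signed_measure := (@Charge.type _ (measurableTypeR R) R).
Implicit Types (a b : R) (f : R -> R) (mu : signed_measure).

(* [mu] is the signed measure df on [a, b]; a signed measure on [a, b] is
   encoded as a charge on the line that does not see the complement of [a, b]. *)
Definition is_differential a b f mu : Prop :=
  [/\ forall x : R, mu [set x] = 0%E,
      forall x y : R, a <= x -> x <= y -> y <= b ->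
        mu `]x, y]%classic = (f y - f x)%:E
    & forall A, measurable A -> mu A = mu (A `&` `[a, b]%classic)].

(* The definite description is justified by [differentialP] and
   [is_differential_unique] below; the zero charge is only a junk value. *)
Definition differential a b f : signed_measure :=
  if pselect (exists mu, is_differential a b f mu) is left h
  then projT1 (cid h) else czero.

(* The integral of [g] over [A] against a signed measure, as the difference of
   the integrals against its Jordan components. These are the same for all Hahn
   decompositions, by [Hahn_decomposition_uniq]. *)
Definition charge_integral mu (A : set R) (g : R -> \bar R) : \bar R :=
  let hP := cid (Hahn_decomposition mu) in
  let hN := cid (projT2 hP) in
  (\int[jordan_pos (projT2 hN)]_(x in A) g x
   - \int[jordan_neg (projT2 hN)]_(x in A) g x)%E.

Section existence.
Variables (a b : R).
Hypothesis ab : a < b.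

Let clamp (x : R) := Num.max a (Num.min x b).

Let clamp_itv x : clamp x \in `[a, b].
Proof.
by rewrite in_itv/= /clamp le_max lexx/= ge_max (ltW ab) ge_min lexx orbT.
Qed.

Let clamp_id x : a <= x -> x <= b -> clamp x = x.
Proof. by rewrite /clamp => ax xb; rewrite min_l// max_r. Qed.

Let clamp_homo : {homo clamp : x y / x <= y}.
Proof.
move=> x y xy; rewrite /clamp /Order.max /Order.min.
by repeat case: ifPn; rewrite -?leNgt; move: ab xy; lra.
Qed.

Let clamp_dist x y : `|clamp x - clamp y| <= `|x - y|.
Proof.
wlog xy : x y / x <= y.
  by move=> h; have [/h//|/ltW/h] := leP x y; rewrite distrC (distrC x).
rewrite distrC (distrC x) !ger0_norm ?subr_ge0 ?clamp_homo//.
rewrite /clamp /Order.max /Order.min.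
by repeat case: ifPn; rewrite -?leNgt; move: ab xy; lra.
Qed.

Let stieltjes_itvoc (F : cumulative R R) x y : x <= y ->
  lebesgue_stieltjes_measure F `]x, y]%classic = (F y - F x)%:E.
Proof.
move=> xy; rewrite /lebesgue_stieltjes_measure /measure_extension.
by rewrite measurable_mu_extE/= ?wlength_itv_bnd//; exact: is_ocitv.
Qed.

Let is_differential_nondecreasing g : {within `[a, b], continuous g} ->
  {in `[a, b] &, {homo g : x y / x <= y}} -> exists mu, is_differential a b g mu.
Proof.
move=> cg ndg; pose G x := g (clamp x).
have ndG : {homo G : x y / x <= y} by move=> x y xy; exact/ndg/clamp_homo.
have cG : continuous G.
  move=> x; apply/cvgrPdist_lt => e e0.
  have /subspace_continuousP/(_ _ (clamp_itv x))/cvgrPdist_lt/(_ e e0) := cg.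
  move=> [d/= d0 hd]; exists d => //= y xy.
  by apply: hd => //=; rewrite (le_lt_trans (clamp_dist _ _)).
pose iC := isCumulative.Build R _ R G ndG (right_continuousW cG).
pose G' : cumulative R R := HB.pack G iC.
pose mu := lebesgue_stieltjes_measure G'.
have muE x y : x <= y -> mu `]x, y]%classic = (G y - G x)%:E.
  exact: stieltjes_itvoc.
have mI (i : interval R) : measurable ([set` i] : set (measurableTypeR R)).
  exact: measurable_itv.
have muoo : (mu `[a, b]%classic < +oo)%E.
  apply: (@le_lt_trans _ _ (mu `]a - 1, b]%classic)).
    apply: le_measure; rewrite ?inE//; apply: subset_itvr.
    by rewrite bnd_simp ltrBlDr ltrDl.
  by rewrite muE ?ltry//; move: ab; lra.
pose nu : {charge set (measurableTypeR R) -> \bar R} :=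
  charge_of_finite_measure (mfrestr (mI `[a, b]) muoo).
have rE A : nu A = mu (A `&` `[a, b]%classic) by [].
exists nu; split.
- move=> x; rewrite rE; apply/eqP; rewrite eq_le measure_ge0 andbT.
  apply/lee_addgt0Pr => e e0; rewrite add0e.
  have /cvgrPdist_lt/(_ e e0)[d/= d0 hd] := cG x.
  apply: (@le_trans _ _ (mu `]x - d / 2, x]%classic)).
    apply: le_measure; rewrite ?inE//.
      by apply: measurableI => //; exact: measurable_set1.
    by move=> _ [-> _]/=; rewrite in_itv/= lexx andbT ltrBlDr ltrDl divr_gt0.
  rewrite muE; last by rewrite lerBlDr lerDl divr_ge0// ltW.
  rewrite lee_fin (le_trans (ler_norm _))// ltW// hd//=.
  by rewrite opprB addrC subrK gtr0_norm ?divr_gt0// ltr_pdivrMr// ltr_pMr// ltr1n.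
- move=> x y ax xy yb; rewrite rE setIidl.
    by rewrite muE// /G !clamp_id// ?(le_trans ax)// (le_trans xy).
  move=> z/=; rewrite !in_itv/= => /andP[xz zy].
  by rewrite (le_trans zy)// andbT (le_trans ax)// ltW.
- by move=> A mA; rewrite !rE -setIA setIid.
Qed.

Lemma is_differential_exists f : {within `[a, b], continuous f} ->
  bounded_variation a b f -> exists mu, is_differential a b f mu.
Proof.
move=> cf bvf.
have cNf : {within `[a, b], continuous (\- f)}.
  by move=> x; apply: continuousN; exact: cf.
have bvNf : bounded_variation a b (\- f) by exact: bounded_variationN.
have key h : {within `[a, b], continuous h} -> bounded_variation a b h ->
    exists mu, is_differential a b (fine \o neg_tv a h) mu.
  move=> ch bvh; apply: is_differential_nondecreasing; last first.
    exact: fine_neg_tv_nondecreasing.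
  have ctvh := total_variation_continuous ab ch bvh.
  apply: (@subspace_eq_continuous _ _ _
    (fun x => (fine (total_variation a x h) - h x) * 2^-1)).
    move=> x; rewrite inE/= in_itv/= => /andP[ax xb].
    have fin : total_variation a x h \is a fin_num.
      by apply/bounded_variationP => //; exact: bounded_variationl bvh.
    by rewrite /from_subspace/= /neg_tv fineM ?fin_numB ?fin// fineB.
  move=> x; apply: (@cvgMr_tmp R); apply: (@cvgB _ R^o); [exact: ctvh|exact: ch].
have [mu1 [p1 o1 r1]] := key _ cNf bvNf.
have [mu2 [p2 o2 r2]] := key _ cf bvf.
pose nu : {charge set (measurableTypeR R) -> \bar R} := cadd mu1 (copp mu2).
have nuE A : nu A = (mu1 A - mu2 A)%E by [].
exists nu; split => [x|x y ax xy yb|A mA]; rewrite !nuE.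
- by rewrite p1 p2 oppe0 adde0.
- have fE := bounded_variation_pos_neg_tvE bvf.
  have [xI yI] : x \in `[a, b] /\ y \in `[a, b].
    by rewrite !in_itv/= ax yb (le_trans xy yb) (le_trans ax xy).
  rewrite o1// o2// -EFinN -EFinD (fE _ xI) (fE _ yI)/= /pos_tv.
  by congr EFin; lra.
- by rewrite r1// (r2 A).
Qed.

Lemma differentialP f : {within `[a, b], continuous f} ->
  bounded_variation a b f -> is_differential a b f (differential a b f).
Proof.
move=> cf bvf; rewrite /differential.
case: pselect => [h|]; last by case; exact: is_differential_exists.
by case: (cid h).
Qed.

End existence.

Lemma is_differential_unique a b f mu nu :
  is_differential a b f mu -> is_differential a b f nu ->
  forall A, measurable A -> mu A = nu A.
Proof.
move=> [pmu omu rmu] [pnu onu rnu].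
have mI (i : interval R) : measurable ([set` i] : set (measurableTypeR R)).
  exact: measurable_itv.
have m1 : measurable ([set a] : set (measurableTypeR R)).
  exact: measurable_set1.
have oc (xi : signed_measure) A : (forall x, xi [set x] = 0%E) ->
    (forall A, measurable A -> xi A = xi (A `&` `[a, b]%classic)) ->
    measurable A -> xi A = xi (A `&` `]a, b]%classic).
  move=> pxi rxi mA.
  have rewA : (A `\` [set a]) `&` `[a, b]%classic = A `&` `]a, b]%classic.
    apply/seteqP; split => z; rewrite /= !in_itv/=.
      move=> [[Az za] /andP[az zb]].
      by rewrite lt_neqAle eq_sym (introN eqP za) az.
    move=> [Az /andP[az zb]]; rewrite (ltW az); split=> //; split=> // za.
    by rewrite za ltxx in az.
  rewrite (chargeDI xi mA m1) [X in (_ + X)%E](_ : _ = 0%E) ?adde0.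
    by rewrite (rxi _ (measurableD mA m1)) rewA.
  have [/set_mem Aa|nAa] := boolP (a \in A).
    by rewrite setIC setIidl ?pxi// => _ ->.
  rewrite (_ : _ `&` _ = set0) ?charge0//; apply/seteqP; split => // z [Az za].
  by move: nAa; rewrite -[X in X \notin _]za notin_setE.
have eqoc x y : mu `]x, y]%classic = nu `]x, y]%classic.
  rewrite (oc _ _ pmu rmu (mI _)) (oc _ _ pnu rnu (mI _)).
  have -> : `]x, y]%classic `&` `]a, b]%classic =
      `]Num.max x a, Num.min y b]%classic :> set R.
    apply/seteqP; split => z; rewrite /= !in_itv/= gt_max le_min.
      by move=> [/andP[-> ->] /andP[-> ->]].
    by move=> /andP[/andP[-> ->] /andP[-> ->]].
  have [h|h] := leP (Num.max x a) (Num.min y b).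
    by rewrite omu ?onu// ?le_max ?ge_min ?lexx ?orbT.
  by rewrite set_itv_ge ?charge0// bnd_simp -leNgt ltW.
have eqT : mu setT = nu setT.
  by rewrite (oc _ _ pmu rmu measurableT) (oc _ _ pnu rnu measurableT) setTI.
move=> A mA; apply: (dynkin_induction (T := measurableTypeR R) (G := @ocitv R)
  (P := fun A => mu A = nu A)) => //.
- exact: ocitvI.
- by move=> _ [[x y] _ <-]/=; exact: eqoc.
- by move=> S mS eqS; rewrite -setTD !chargeD// eqT !setTI eqS.
- move=> F mF tF eqF.
  have mUF : measurable (\bigcup_k F k) by exact: bigcup_measurable.
  have cmu := @charge_semi_sigma_additive _ _ _ mu F mF tF mUF.
  have cnu := @charge_semi_sigma_additive _ _ _ nu F mF tF mUF.
  have : (fun n => \sum_(0 <= i < n) nu (F i))%E =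
         (fun n => \sum_(0 <= i < n) mu (F i))%E.
    by apply/funext => n; apply: eq_bigr => i _; rewrite eqF.
  by move=> E; rewrite E in cnu; exact: cvg_unique cmu cnu.
Qed.

End signed_stieltjes.

Section luckock.
Context {R : realType}.

Definition luckock_solution (Jm Jp : R) (lamm lamp fm fp : R -> R) : Prop :=
  [/\ {within `[Jm, Jp], continuous fm} /\ bounded_variation Jm Jp fm,
      {within `[Jm, Jp], continuous fp} /\ bounded_variation Jm Jp fp,
      forall A : set (measurableTypeR R), measurable A -> A `<=` `[Jm, Jp] ->
        (charge_integral (differential Jm Jp lamp) A (EFin \o fm)
         + charge_integral (differential Jm Jp fp) A (EFin \o lamm) = 0)%E,
      forall A : set (measurableTypeR R), measurable A -> A `<=` `[Jm, Jp] ->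
        (charge_integral (differential Jm Jp lamm) A (EFin \o fp)
         + charge_integral (differential Jm Jp fm) A (EFin \o lamp) = 0)%E
    & fm Jp = 1 /\ fp Jm = 1].

Variables (Im Ip : \bar R) (lamm lamp : \bar R -> R).

Definition Vmax : R := Num.min (lamm Im) (lamp Ip).

Definition VW : R :=
  sup [set Num.min (lamm x) (lamp x) | x in `[Im, Ip]%classic].

Definition lamm_inv (V : R) : \bar R :=
  ereal_sup [set x | x \in `[Im, Ip] /\ V <= lamm x].

Definition lamp_inv (V : R) : \bar R :=
  ereal_inf [set x | x \in `[Im, Ip] /\ V <= lamp x].

(* The inverses in the integrand are those of [\bar R], where 0^-1 = +oo. *)
Definition Phi (V : R) : \bar R :=
  (- charge_integral (differential VW V (fun W => W^-1)%R) `[VW, V]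
       (fun W => (lamp (lamm_inv W))%:E^-1 + (lamm (lamp_inv W))%:E^-1))%E.

End luckock.

(* Main.v *)
Require Import Defs.
From mathcomp Require Import all_boot all_order all_algebra.
From mathcomp Require Import all_classical all_reals all_analysis.
From mathcomp Require Import measurable_realfun ring lra.
Import Order.TTheory GRing.Theory Num.Theory.
Import numFieldNormedType.Exports.
Local Open Scope classical_set_scope.
Local Open Scope ring_scope.

(** The sum [fm lamp + fp lamm] is a constant [c], whence
    [fm Jm * lamp Jm = c - V = fp Jp * lamm Jp], and only the sign of [c - V]
    matters. Eliminating one unknown from each equation gives
    [d(fm / lamm) = (c / lamp) d(1 / lamm)] and
    [d(fp / lamp) = (c / lamm) d(1 / lamp)]. Let [z] be a point where
    [lamm z = lamp z = VW]. Integrate the first identity over [Jm, z] and the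
    second over [z, Jp]: the substitutions [W = lamm x] and [W = lamp x] turn the
    right-hand sides into the two summands of [Phi V], and adding up yields
    [c (VW^-2 - Phi V) = (fm Jm + fp Jp) / V]. Finally [c > 0], since otherwise
    [fm / lamm] would be nonincreasing on [Jm, Jp], which contradicts
    [fm Jm < 0 < fm Jp].

    Product rules and substitutions for Stieltjes measures are obtained by
    comparing increments: two functions of an interval are identified when their
    difference is of smaller order than the increment of some monotone function,
    because such errors vanish in the limit of fine subdivisions. *)

Set Implicit Arguments.
Unset Strict Implicit.

(** Freezing the integrand at a constant [k] costs at most [e] times the mass. On intervals where
    [h] oscillates little, this replaces an integral by a product. *)
Lemma Rintegral_oscillation {d} {T : measurableType d} {R : realType}
    (nu : {finite_measure set T -> \bar R}) (A : set T) (h : T -> R) (k e : R) :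
  measurable A -> measurable_fun A h -> (forall x, A x -> `|h x - k| <= e) ->
  nu.-integrable A (EFin \o h) /\
  `|\int[nu]_(x in A) h x - k * fine (nu A)| <= e * fine (nu A).
Proof.
move=> mA mh hk.
have nuA : (nu A < +oo)%E by rewrite ltey_eq fin_num_measure.
have ih : nu.-integrable A (EFin \o h).
  apply: measurable_bounded_integrable => //.
  exists (`|k| + e); split; first exact: num_real.
  move=> M kM x Ax; apply: (le_trans _ (ltW kM)).
  by rewrite -[h x](subrK k) (le_trans (ler_normD _ _))// addrC lerD2l hk.
have ic (r : R) : nu.-integrable A (EFin \o cst r).
  exact: finite_measure_integrable_cst.
split=> //; rewrite -!Rintegral_cst// -RintegralB//; last exact: (ic k).
have id : nu.-integrable A (EFin \o (fun x => h x - k)).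
  rewrite (_ : _ \o _ = ((EFin \o h) \- (EFin \o cst k))%E).
    exact: integrableB.
  by apply/funext => x /=; rewrite EFinB.
apply: (le_trans (le_normr_Rintegral mA id)).
by apply: le_Rintegral => //; [exact: (integrable_norm id)|exact: (ic e)].
Qed.

(** * Integrals against a signed measure *)

Section charge_variation_integral.
Context {d} {T : measurableType d} {R : realType}.
Implicit Types (mu : {charge set T -> \bar R}) (A B : set T) (h g : T -> R).
Implicit Types (k e : R).

Let decP mu := projT2 (cid (projT2 (cid (Hahn_decomposition mu)))).

(* The Hahn decomposition chosen by [charge_integral], so that [charge_integralE]
   holds by conversion. *)
Definition charge_pos mu : {finite_measure set T -> \bar R} :=
  jordan_pos (decP mu).

Definition charge_neg mu : {finite_measure set T -> \bar R} :=
  jordan_neg (decP mu).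

(** The total variation of [mu] on [A], as a real number. *)
Definition charge_var mu A : R := fine (charge_pos mu A) + fine (charge_neg mu A).

Definition charge_Rintegral mu A h : R :=
  \int[charge_pos mu]_(x in A) h x - \int[charge_neg mu]_(x in A) h x.

Definition charge_integrable mu A h :=
  (charge_pos mu).-integrable A (EFin \o h) /\
  (charge_neg mu).-integrable A (EFin \o h).

Lemma charge_fineE mu A : measurable A ->
  mu A = (fine (charge_pos mu A) - fine (charge_neg mu A))%:E.
Proof.
move=> mA; rewrite (jordan_decomp (decP mu) mA) EFinB !fineK ?fin_num_measure//.
 by rewrite /cadd /= cscaleN1.
Qed.

Lemma charge_var_ge0 mu A : 0 <= charge_var mu A.
Proof. by rewrite addr_ge0// fine_ge0. Qed.

Lemma charge_le_var mu A : measurable A -> `|fine (mu A)| <= charge_var mu A.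
Proof.
move=> mA; rewrite charge_fineE//= (le_trans (ler_normB _ _))//.
by rewrite !ger0_norm// fine_ge0.
Qed.

Lemma charge_varU mu A B : measurable A -> measurable B -> A `&` B = set0 ->
  charge_var mu (A `|` B) = charge_var mu A + charge_var mu B.
Proof.
move=> mA mB AB; rewrite /charge_var !measureU// !fineD ?fin_num_measure//.
by rewrite addrACA.
Qed.

(** A singleton meets each Hahn set in itself or in the empty set, so both Jordan components vanish
    on it as soon as [mu] does. *)
Lemma charge_var_set1 mu (x : T) : measurable [set x] ->
  mu [set x] = 0%E -> charge_var mu [set x] = 0.
Proof.
move=> m1 mux; have key (P : set T) : mu ([set x] `&` P) = 0%E.
  have [Px|Px] := pselect (P x); first by rewrite setIidl// => _ ->.
  by rewrite (_ : _ `&` _ = set0) ?charge0//; apply/seteqP; split => // z [->].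
have -> : charge_var mu [set x] = fine (jordan_pos (decP mu) [set x]) +
    fine (jordan_neg (decP mu) [set x]) by [].
by rewrite jordan_posE jordan_negE cjordan_posE cjordan_negE /crestr0 mem_set// /crestr
  !key oppe0 addr0.
Qed.

(** The bound for finite measures applies to both Jordan components, and the two errors add up to
    the total variation. *)
Lemma charge_integral_oscillation mu A h k e :
  measurable A -> measurable_fun A h ->
  (forall x, A x -> `|h x - k| <= e) ->
  charge_integrable mu A h /\
  `|charge_Rintegral mu A h - k * fine (mu A)| <= e * charge_var mu A.
Proof.
move=> mA mh hk.
have [ip dp] := Rintegral_oscillation (charge_pos mu) mA mh hk.
have [im dm] := Rintegral_oscillation (charge_neg mu) mA mh hk.
split=> //; rewrite charge_fineE//= /charge_Rintegral /charge_var.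
move: dp dm; rewrite !ler_norml => /andP[? ?] /andP[? ?]; apply/andP; split; lra.
Qed.

Lemma charge_RintegralD mu A h g : measurable A ->
  charge_integrable mu A h -> charge_integrable mu A g ->
  charge_integrable mu A (h \+ g) /\
  charge_Rintegral mu A (h \+ g) = charge_Rintegral mu A h + charge_Rintegral mu A g.
Proof.
move=> mA [hp hm] [gp gm]; split.
  split; rewrite (_ : _ \o _ = ((EFin \o h) \+ (EFin \o g))%E) //;
  exact: integrableD.
by rewrite /charge_Rintegral !RintegralD//; ring.
Qed.

Lemma charge_RintegralU mu A B h : measurable A ->
  measurable B -> A `&` B = set0 ->
  charge_integrable mu (A `|` B) h ->
  charge_Rintegral mu (A `|` B) h = charge_Rintegral mu A h + charge_Rintegral mu B h.
Proof.
move=> mA mB AB [hp hm]; have dAB : [disjoint A & B] by exact/disj_set2P.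
by rewrite /charge_Rintegral !Rintegral_setU//; ring.
Qed.

End charge_variation_integral.

Lemma charge_integralE {R : realType} (mu : @Charge.type _ (measurableTypeR R) R)
    (A : set (measurableTypeR R)) (h : R -> R) : measurable A ->
  charge_integrable mu A h ->
  charge_integral mu A (EFin \o h) = (charge_Rintegral mu A h)%:E.
Proof.
move=> mA [ip im]; rewrite EFinB /Rintegral.
have fp : (\int[charge_pos mu]_(x in A) (EFin \o h) x)%E \is a fin_num.
  exact: integrable_fin_num.
have fm : (\int[charge_neg mu]_(x in A) (EFin \o h) x)%E \is a fin_num.
  exact: integrable_fin_num.
by rewrite (fineK fp) (fineK fm).
Qed.

(** * Negligible functions of an interval *)

Section interval_functions.
Context {R : realType}.
Implicit Types (a b e d x y : R) (F f k l m : R -> R) (G K : R -> R -> R).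

Definition delta f : R -> R -> R := fun x y => f y - f x.

Definition bounded2 a b G :=
  exists C, forall x y, a <= x -> x <= y -> y <= b -> `|G x y| <= C.

Definition vanishing a b G := forall e, 0 < e -> exists2 d, 0 < d &
  forall x y, a <= x -> x <= y -> y <= b -> y - x < d -> `|G x y| <= e.

(** For [G = delta g] this expresses bounded variation of [g], with a variation function as a
    possible [m]. *)
Definition var_dominated a b G := exists m,
  forall x y, a <= x -> x <= y -> y <= b -> `|G x y| <= m y - m x.

(* [G x y = o(m y - m x)] uniformly, for some monotone [m]: the sum of [G] along a
   subdivision tends to 0 with the mesh. *)
Definition negl a b G := exists2 m,
  (forall x y, a <= x -> x <= y -> y <= b -> m x <= m y) &
  forall e, 0 < e -> exists2 d, 0 < d &
  forall x y, a <= x -> x <= y -> y <= b -> y - x < d ->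
    `|G x y| <= e * (m y - m x).

Lemma eq_negl a b G K :
  (forall x y, a <= x -> x <= y -> y <= b -> G x y = K x y) ->
  negl a b G -> negl a b K.
Proof.
move=> GK [m nm H]; exists m => // e /H[d d0 Hd]; exists d => // x y ax xy yb.
by rewrite -GK//; exact: Hd.
Qed.

Lemma neglS a b a' b' G : a <= a' -> b' <= b ->
  negl a b G -> negl a' b' G.
Proof.
move=> aa bb [m nm H]; exists m => [x y ax xy yb|e /H[d d0 Hd]].
  by apply: nm => //; [exact: le_trans ax|exact: le_trans bb].
exists d => // x y ax xy yb; apply: Hd => //.
  exact: le_trans ax.
exact: le_trans bb.
Qed.

Lemma neglD a b G K : negl a b G -> negl a b K ->
  negl a b (fun x y => G x y + K x y).
Proof.
move=> [m1 n1 H1] [m2 n2 H2].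
exists (fun x => m1 x + m2 x) => [x y ax xy yb|e e0].
  by rewrite lerD ?n1 ?n2.
have [d1 d10 Hd1] := H1 _ e0; have [d2 d20 Hd2] := H2 _ e0.
exists (Num.min d1 d2) => [|x y ax xy yb]; first by rewrite lt_min d10.
rewrite lt_min => /andP[yx1 yx2]; rewrite (le_trans (ler_normD _ _))//.
by have := Hd1 _ _ ax xy yb yx1; have := Hd2 _ _ ax xy yb yx2; lra.
Qed.

Lemma neglM a b G K : bounded2 a b K -> negl a b G ->
  negl a b (fun x y => K x y * G x y).
Proof.
move=> [C KC] [m nm H]; exists (fun x => (`|C| + 1) * m x) => [x y ax xy yb|e e0].
  by rewrite ler_wpM2l ?nm// addr_ge0.
have [d d0 Hd] := H _ e0; exists d => // x y ax xy yb yx.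
rewrite normrM -mulrBr mulrCA ler_pM//; last exact: Hd.
by rewrite (le_trans (KC _ _ ax xy yb))// (le_trans (ler_norm C))// lerDl.
Qed.

(** This disposes of the second-order terms [delta f * delta l] in product rules, with [f]
    continuous and [l] of bounded variation. *)
Lemma vanishing_var_dominated a b G K : vanishing a b K -> var_dominated a b G ->
  negl a b (fun x y => K x y * G x y).
Proof.
move=> vK [m mG]; exists m => [x y ax xy yb|e e0].
  by rewrite -subr_ge0 (le_trans _ (mG _ _ ax xy yb)).
have [d d0 Hd] := vK _ e0; exists d => // x y ax xy yb yx.
by rewrite normrM ler_pM// ?Hd ?mG.
Qed.

(** On a fine subdivision each increment of [F] is at most [e] times that of [m]. The increments
    telescope to [e * (m b - m a)], and [e] is arbitrary. *)
Lemma negl_le a b F G : a <= b ->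
  (forall x y, a <= x -> x <= y -> y <= b -> F y - F x <= G x y) ->
  negl a b G -> F b <= F a.
Proof.
move=> ab FG [m nm H].
suff key e : 0 < e -> F b - F a <= e * (m b - m a).
  rewrite -subr_le0; apply/ler_addgt0Pr => e e0; rewrite add0r.
  have mab : 0 <= m b - m a by rewrite subr_ge0 nm.
  (* The added 1 keeps the denominator positive when [m b = m a]. *)
  have q0 : 0 < e / (m b - m a + 1) by rewrite divr_gt0// ltr_wpDl.
  apply: (le_trans (key _ q0)); rewrite mulrAC ler_pdivrMr ?ltr_wpDl//.
  by rewrite ler_pM2l// lerDl.
move=> e0; have [d d0 Hd] := H _ e0.
(* Repeated bisection reduces to lengths below [d]; the bounds on the two halves add up because
   [m y - m x] is additive. *)
have dyadic n x y : a <= x -> x <= y -> y <= b -> y - x < 2 ^+ n * d ->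
    F y - F x <= e * (m y - m x).
  elim: n x y => [|n IH] x y ax xy yb.
    rewrite expr0 mul1r => yx; rewrite (le_trans (FG _ _ ax xy yb))//.
    by rewrite (le_trans (ler_norm _)) ?Hd.
  rewrite exprS -mulrA => yx; pose z := (x + y) / 2.
  have [xz zy] : x <= z /\ z <= y by rewrite /z; split; lra.
  have := IH x z ax xz (le_trans zy yb); have := IH z y (le_trans ax xz) zy yb.
  by move=> /(_ _)/wrap[|h1 /(_ _)/wrap[|h2]]; rewrite /z; lra.
(* This exponent [n] exceeds [(b - a) / d], and [n < 2 ^ n]. *)
apply: (dyadic (Num.truncn ((b - a) / d)).+1 a b) => //.
rewrite -ltr_pdivrMr// (lt_le_trans (truncnS_gt _))//.
by rewrite -natrX ler_nat ltnW// ltn_expl.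
Qed.

Lemma negl_delta a b F : a <= b -> negl a b (delta F) -> F b = F a.
Proof.
move=> ab nF; apply/eqP; rewrite eq_le; apply/andP; split.
  exact: (negl_le ab _ nF).
rewrite -lerN2; apply: (@negl_le a b (\- F) (fun x y => -1 * delta F x y)) => //.
  by move=> x y _ _ _; rewrite /delta/=; lra.
by apply: neglM => //; exists 1 => *; rewrite normrN1.
Qed.

(** This is uniform continuity on a segment. Compactness, in its covering form, turns a scale valid
    near each point into one scale [d] valid for all points. *)
Lemma vanishing_delta a b f : {within `[a, b], continuous f} ->
  vanishing a b (delta f).
Proof.
move=> /subspace_continuousP cf e e0.
have e20 : 0 < e / 2 by rewrite divr_gt0.
pose P d x := a <= x <= b ->
  forall y, a <= y <= b -> `|x - y| < d -> `|f x - f y| <= e.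
have /compact_near_coveringP/(_ R 0^'+ P _) cov := @segment_compact R a b.
have : \forall d \near 0^'+, `[a, b] `<=` P d.
  apply: cov => x xab.
  have /cvgrPdist_lt/(_ _ e20)[d/= d0 Hd] := cf _ xab.
  (* With halves, both [z] and any [y] at distance less than [r] from [z] stay within [d] of the
     centre [x]. *)
  exists (ball x (d / 2), [set r | r < d / 2]).
    split=> /=; first by apply: nbhsx_ballx; rewrite divr_gt0.
    by apply: nbhs_right_lt; rewrite divr_gt0.
  move=> [z r] /= [xz rd] zab y yab zy.
  have fz : `|f x - f z| < e / 2.
    by apply: Hd => //=; move: xz; rewrite /ball/=; lra.
  have fy : `|f x - f y| < e / 2.
    apply: Hd => //=; rewrite -(subrKA z) (le_lt_trans (ler_normD _ _))//.
    by move: xz zy rd; rewrite /ball/=; lra.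
  have -> : f z - f y = (f x - f y) - (f x - f z) by ring.
  by rewrite (le_trans (ler_normB _ _))//; lra.
move=> /(filterI (nbhs_right_gt 0))/filter_ex[d [d0 Hd]].
exists d => // x y ax xy yb yx; rewrite distrC; apply: (Hd x).
- by rewrite /= in_itv/= ax (le_trans xy).
- by rewrite ax (le_trans xy).
- by rewrite (le_trans ax).
- by rewrite distrC ger0_norm ?subr_ge0.
Qed.

End interval_functions.

(** * Luckock's equation in terms of increments *)

Section luckock_calculus.
Context {R : realType}.
Implicit Types (a b c e x y : R) (f g h k l p : R -> R).

(** By the product rule, the increment of [f1 * l2 + f2 * l1] is the sum of the two equations plus
    the cross terms [delta f1 * delta l2] and [delta f2 * delta l1], all negligible. *)
Lemma luckock_invariant a b f1 f2 l1 l2 :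
  vanishing a b (delta f1) -> vanishing a b (delta f2) ->
  var_dominated a b (delta l1) -> var_dominated a b (delta l2) ->
  negl a b (fun x y => f1 x * delta l2 x y + l1 x * delta f2 x y) ->
  negl a b (fun x y => f2 x * delta l1 x y + l2 x * delta f1 x y) ->
  forall x, a <= x -> x <= b -> f1 x * l2 x + f2 x * l1 x = f1 a * l2 a + f2 a * l1 a.
Proof.
move=> v1 v2 d1 d2 n12 n21 x ax xb.
apply: (@negl_delta _ a x (fun x => f1 x * l2 x + f2 x * l1 x)) => //.
apply: (@neglS _ a b) => //.
have := neglD (neglD n12 n21)
  (neglD (vanishing_var_dominated v1 d2)
                       (vanishing_var_dominated v2 d1)).
by apply: eq_negl => y z _ _ _; rewrite /delta; ring.
Qed.

(** Writing [c] as [f1 x * l2 x + f2 x * l1 x] makes the expression exactly [(l2 x * l1 y)^-1] times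
    the increment in the equation. The lower bound [w] keeps that factor bounded. *)
Lemma luckock_quotient a b c f1 f2 l1 l2 (w : R) : 0 < w ->
  (forall x, a <= x -> x <= b -> w <= l1 x /\ w <= l2 x) ->
  (forall x, a <= x -> x <= b -> f1 x * l2 x + f2 x * l1 x = c) ->
  negl a b (fun x y => f2 x * delta l1 x y + l2 x * delta f1 x y) ->
  negl a b (fun x y => delta (fun z => f1 z / l1 z) x y
    - c / l2 x * delta (fun z => (l1 z)^-1) x y).
Proof.
move=> w0 wl fc n21.
have bK : bounded2 a b (fun x y => (l2 x * l1 y)^-1).
  exists (w * w)^-1 => x y ax xy yb.
  have [_ l2x] := wl x ax (le_trans xy yb).
  have [l1y _] := wl y (le_trans ax xy) yb.
  have l2x0 := lt_le_trans w0 l2x; have l1y0 := lt_le_trans w0 l1y.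
  have p0 : 0 < l2 x * l1 y by rewrite mulr_gt0.
  rewrite ger0_norm ?invr_ge0 ?(ltW p0)//.
  by rewrite lef_pV2 ?posrE ?mulr_gt0// ler_pM// ltW.
apply: eq_negl (neglM bK n21) => x y ax xy yb.
have [l1x l2x] := wl x ax (le_trans xy yb).
have [l1y _] := wl y (le_trans ax xy) yb.
have l1x0 : l1 x != 0 by rewrite gt_eqF// (lt_le_trans w0).
have l2x0 : l2 x != 0 by rewrite gt_eqF// (lt_le_trans w0).
have l1y0 : l1 y != 0 by rewrite gt_eqF// (lt_le_trans w0).
rewrite -(fc x ax (le_trans xy yb)) /delta.
by field; rewrite l1x0 l2x0 l1y0.
Qed.

(** Here [p] is a primitive of [- (1 / l2) d(1 / l1)], so the differential of [f1 / l1 + c * p]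
    vanishes. *)
Lemma luckock_quotient_primitive a b c f1 f2 l1 l2 p (w : R) : a <= b -> 0 < w ->
  (forall x, a <= x -> x <= b -> w <= l1 x /\ w <= l2 x) ->
  (forall x, a <= x -> x <= b -> f1 x * l2 x + f2 x * l1 x = c) ->
  negl a b (fun x y => f2 x * delta l1 x y + l2 x * delta f1 x y) ->
  negl a b (fun x y => delta p x y
    + (l2 x)^-1 * delta (fun z => (l1 z)^-1) x y) ->
  f1 b / l1 b + c * p b = f1 a / l1 a + c * p a.
Proof.
move=> ab w0 wl fc n21 np.
have bc : bounded2 a b (fun _ _ => c) by exists `|c|.
have nq := luckock_quotient w0 wl fc n21.
apply: (@negl_delta _ a b (fun x => f1 x / l1 x + c * p x) ab).
apply: eq_negl (neglD nq (neglM bc np)) => x y _ _ _.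
by rewrite /delta; ring.
Qed.

(** Since [1 / l1] is nondecreasing, [(c / l2) d(1 / l1)] has the sign of [c]. This serves to
    exclude [c <= 0]. *)
Lemma luckock_quotient_nonincreasing a b c f1 f2 l1 l2 (w : R) : a <= b -> 0 < w ->
  (forall x, a <= x -> x <= b -> w <= l1 x /\ w <= l2 x) ->
  (forall x y, a <= x -> x <= y -> y <= b -> l1 y <= l1 x) ->
  (forall x, a <= x -> x <= b -> f1 x * l2 x + f2 x * l1 x = c) ->
  negl a b (fun x y => f2 x * delta l1 x y + l2 x * delta f1 x y) ->
  c <= 0 -> f1 b / l1 b <= f1 a / l1 a.
Proof.
move=> ab w0 wl ml fc n21 c0.
have nq := luckock_quotient w0 wl fc n21.
apply: (@negl_le _ a b (fun x => f1 x / l1 x) _ ab _ nq) => x y ax xy yb.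
have [l1x l2x] := wl x ax (le_trans xy yb).
have [l1y _] := wl y (le_trans ax xy) yb.
have q0 : 0 <= - c / l2 x by rewrite divr_ge0 ?oppr_ge0// (le_trans (ltW w0)).
have m0 : 0 <= (l1 y)^-1 - (l1 x)^-1.
  by rewrite subr_ge0 lef_pV2 ?ml// posrE (lt_le_trans w0).
by have := mulr_ge0 q0 m0; rewrite /delta !mulNr; lra.
Qed.

End luckock_calculus.

(** * Increments of Stieltjes differentials and change of variables *)

Section differentials.
Context {R : realType}.
Local Notation signed_measure := (@Charge.type _ (measurableTypeR R) R).
Implicit Types (a b e x y : R) (f g h k l : R -> R) (mu nu : signed_measure).

Definition cumulative_var mu a : R -> R := fun x => charge_var mu `]a, x]%classic.

Lemma measurable_itvR (i : interval R) :
  measurable ([set` i] : set (measurableTypeR R)).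
Proof. exact: measurable_itv. Qed.

Lemma itv_ocU a x y : a <= x -> x <= y ->
  `]a, y]%classic = `]a, x]%classic `|` `]x, y]%classic.
Proof. by move=> ax xy; rewrite (itv_bndbnd_setU (x := BRight x)). Qed.

Lemma itv_ocI a x y : `]a, x]%classic `&` `]x, y]%classic = set0.
Proof.
apply/seteqP; split => // z []; rewrite /= !in_itv/= => /andP[_ zx] /andP[xz _].
by move: (lt_le_trans xz zx); rewrite ltxx.
Qed.

Lemma cumulative_varB mu a x y : a <= x -> x <= y ->
  cumulative_var mu a y - cumulative_var mu a x = charge_var mu `]x, y]%classic.
Proof.
move=> ax xy; rewrite /cumulative_var (itv_ocU ax xy)// charge_varU.
- by rewrite addrC addKr.
- exact: measurable_itvR.
- exact: measurable_itvR.
- exact: itv_ocI.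
Qed.

Lemma cumulative_var_nondecreasing mu a x y : a <= x -> x <= y ->
  cumulative_var mu a x <= cumulative_var mu a y.
Proof. by move=> ax xy; rewrite -subr_ge0 cumulative_varB// charge_var_ge0. Qed.

Lemma differential_var_dominated a b g mu : is_differential a b g mu ->
  var_dominated a b (delta g).
Proof.
move=> [_ omu _]; exists (cumulative_var mu a) => x y ax xy yb.
rewrite cumulative_varB// (_ : delta g x y = fine (mu `]x, y]%classic)).
  by apply: charge_le_var; exact: measurable_itvR.
by rewrite omu.
Qed.

Lemma continuous_measurable_itv a b f x y : {within `[a, b], continuous f} ->
  a <= x -> y <= b ->
  measurable_fun (`]x, y]%classic : set (measurableTypeR R)) f.
Proof.
move=> cf ax yb; apply: (measurable_funS (E := `[a, b]%classic)).
- exact: measurable_itvR.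
- by apply: subset_itv; rewrite bnd_simp.
- apply: subspace_continuous_measurable_fun => //; exact: measurable_itvR.
Qed.

Lemma differential_oscillation a b g mu h (q : R) e x y : is_differential a b g mu ->
  a <= x -> x <= y -> y <= b ->
  measurable_fun (`]x, y]%classic : set (measurableTypeR R)) h ->
  (forall z, x < z -> z <= y -> `|h z - q| <= e) ->
  charge_integrable mu `]x, y]%classic h /\
  `|charge_Rintegral mu `]x, y]%classic h - q * (g y - g x)| <=
    e * (cumulative_var mu a y - cumulative_var mu a x).
Proof.
move=> [_ omu _] ax xy yb mh hk.
have {}hk z : `]x, y]%classic z -> `|h z - q| <= e.
  by rewrite /= in_itv/= => /andP[xz zy]; exact: hk.
have [ih] := charge_integral_oscillation mu (measurable_itvR _) mh hk.
by rewrite omu//= cumulative_varB//.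
Qed.

(** The equation is tested on []x, y]] with both densities frozen at [x]. Their continuity makes the
    error small relative to the sum of the two total variations. *)
Lemma differential_equation_negl a b f l k g mu nu :
  {within `[a, b], continuous f} -> {within `[a, b], continuous k} ->
  is_differential a b l mu -> is_differential a b g nu ->
  (forall A : set (measurableTypeR R), measurable A -> A `<=` `[a, b] ->
    (charge_integral mu A (EFin \o f) + charge_integral nu A (EFin \o k) = 0)%E) ->
  negl a b (fun x y => f x * delta l x y + k x * delta g x y).
Proof.
move=> cf ck dl dg eqA.
exists (fun x => cumulative_var mu a x + cumulative_var nu a x).
  by move=> x y ax xy yb; rewrite lerD// cumulative_var_nondecreasing.
move=> e e0.
have [d1 d10 Hf] := vanishing_delta cf e0.
have [d2 d20 Hk] := vanishing_delta ck e0.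
exists (Num.min d1 d2) => [|x y ax xy yb]; first by rewrite lt_min d10.
rewrite lt_min => /andP[yx1 yx2].
have osc h d : y - x < d -> (forall x y, a <= x -> x <= y -> y <= b -> y - x < d ->
    `|delta h x y| <= e) -> forall z, x < z -> z <= y -> `|h z - h x| <= e.
  move=> yx Hh z xz zy; apply: (Hh x z) => //; first exact: ltW.
    exact: le_trans yb.
  by rewrite (le_lt_trans _ yx)// lerD2r.
have mf := continuous_measurable_itv cf ax yb.
have mk := continuous_measurable_itv ck ax yb.
have [intf If] := differential_oscillation dl ax xy yb mf (osc _ _ yx1 Hf).
have [intk Ik] := differential_oscillation dg ax xy yb mk (osc _ _ yx2 Hk).
have sub : `]x, y]%classic `<=` `[a, b]%classic.
  by apply: subset_itv; rewrite bnd_simp.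
have := eqA _ (measurable_itvR _) sub.
rewrite !charge_integralE//; try exact: measurable_itvR.
rewrite -EFinD => -[I0]; move: If Ik; rewrite /delta !ler_norml.
by move=> /andP[? ?] /andP[? ?]; apply/andP; split; lra.
Qed.

(** The indefinite integral of [h] has differential [h dg]. The bound [C] provides the integrability
    needed to split the integral at [x]. *)
Lemma differential_primitive a b g mu h (C : R) x y (q : R) e :
  is_differential a b g mu ->
  measurable_fun (`[a, b]%classic : set (measurableTypeR R)) h ->
  (forall z, a <= z -> z <= b -> `|h z| <= C) ->
  a <= x -> x <= y -> y <= b ->
  (forall z, x < z -> z <= y -> `|h z - q| <= e) ->
  `|charge_Rintegral mu `]a, y]%classic h - charge_Rintegral mu `]a, x]%classic h
    - q * (g y - g x)| <= e * (cumulative_var mu a y - cumulative_var mu a x).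
Proof.
move=> dg mh hC ax xy yb hk.
have mhoc z : z <= b -> measurable_fun (`]a, z]%classic : set (measurableTypeR R)) h.
  move=> zb; apply: (measurable_funS _ _ mh); first exact: measurable_itvR.
  by apply: subset_itv; rewrite bnd_simp.
have hC0 z : a < z -> z <= b -> `|h z - 0| <= C.
  by move=> az zb; rewrite subr0 hC// ltW.
have [iy _] := differential_oscillation dg (lexx a)
  (le_trans ax xy) yb (mhoc _ yb) (fun z az zy => hC0 z az (le_trans zy yb)).
have mhxy : measurable_fun (`]x, y]%classic : set (measurableTypeR R)) h.
  apply: (measurable_funS _ _ (mhoc _ yb)); first exact: measurable_itvR.
  by apply: subset_itv; rewrite bnd_simp.
have [_] := differential_oscillation dg ax xy yb mhxy hk.
move: iy; rewrite (itv_ocU ax xy)// => iy.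
rewrite [charge_Rintegral mu (_ `|` _) h]charge_RintegralU//.
- by rewrite [X in _ -> `|X - _| <= _]addrAC subrr add0r.
- exact: itv_ocI.
Qed.

(** This is the substitution [z = l t]: if [H] is a primitive of [h dg], then
    [d(H o l) = k d(g o l)]. Neither continuity of [h] nor injectivity of [l] is assumed; it
    suffices that between [l x] and [l y] the function [h] takes values of [k] on [[x, y]]. *)
Lemma differential_primitive_negl a b c d g l mu h k (C : R) :
  is_differential a b g mu ->
  measurable_fun (`[a, b]%classic : set (measurableTypeR R)) h ->
  (forall z, a <= z -> z <= b -> `|h z| <= C) ->
  vanishing c d (delta k) ->
  (forall x, c <= x -> x <= d -> a <= l x /\ l x <= b) ->
  (forall x y, c <= x -> x <= y -> y <= d -> l y <= l x) \/
  (forall x y, c <= x -> x <= y -> y <= d -> l x <= l y) ->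
  (forall x y, c <= x -> x <= y -> y <= d -> forall z,
    Num.min (l x) (l y) < z -> z <= Num.max (l x) (l y) ->
    exists2 t, x <= t <= y & h z = k t) ->
  negl c d (fun x y =>
    delta (fun t => charge_Rintegral mu `]a, l t]%classic h) x y
    - k x * delta (fun t => g (l t)) x y).
Proof.
move=> dg mh hC vk lab ml hk.
have near_k e : 0 < e -> exists2 r, 0 < r &
    forall x y, c <= x -> x <= y -> y <= d -> y - x < r -> forall z,
    Num.min (l x) (l y) < z -> z <= Num.max (l x) (l y) -> `|h z - k x| <= e.
  move=> /vk[r r0 Hr]; exists r => // x y cx xy yd yx z zl zr.
  have [t /andP[xt ty] ->] := hk x y cx xy yd z zl zr.
  apply: (Hr x t) => //; first exact: le_trans yd.
  by rewrite (le_lt_trans _ yx)// lerD2r.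
have labl x y : c <= x -> x <= y -> y <= d -> a <= l x /\ l x <= b.
  by move=> cx xy yd; apply: lab => //; exact: le_trans yd.
have labr x y : c <= x -> x <= y -> y <= d -> a <= l y /\ l y <= b.
  by move=> cx xy yd; apply: lab => //; exact: le_trans xy.
have prim := differential_primitive dg mh hC.
case: ml => ml.
(* The sign makes the composite with a nonincreasing [l] nondecreasing. *)
- exists (fun x => - cumulative_var mu a (l x)) => [x y cx xy yd|e e0].
    rewrite lerN2 cumulative_var_nondecreasing ?ml//.
    by have [] := labr _ _ cx xy yd.
  have [r r0 Hr] := near_k _ e0; exists r => // x y cx xy yd yx.
  have lyx := ml _ _ cx xy yd.
  have := Hr x y cx xy yd yx; rewrite min_r// max_l// => hz.
  have [aly _] := labr _ _ cx xy yd; have [_ lxb] := labl _ _ cx xy yd.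
  have := prim _ _ _ _ aly lyx lxb hz.
  by rewrite /delta !ler_norml => /andP[? ?]; apply/andP; split; lra.
- exists (fun x => cumulative_var mu a (l x)) => [x y cx xy yd|e e0].
    rewrite cumulative_var_nondecreasing ?ml//.
    by have [] := labl _ _ cx xy yd.
  have [r r0 Hr] := near_k _ e0; exists r => // x y cx xy yd yx.
  have lxy := ml _ _ cx xy yd.
  have := Hr x y cx xy yd yx; rewrite min_l// max_r// => hz.
  have [_ lyb] := labr _ _ cx xy yd; have [alx _] := labl _ _ cx xy yd.
  exact: prim _ _ _ _ alx lxy lyb hz.
Qed.

End differentials.

(** Clamping the argument to [[a, b]] extends [h] to a monotone function on the whole line. *)
Lemma nondecreasing_itv_measurable {R : realType} (a b : R) (h : R -> R) : a <= b ->
  (forall x y, a <= x -> x <= y -> y <= b -> h x <= h y) ->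
  measurable_fun (`[a, b]%classic : set (measurableTypeR R)) h.
Proof.
move=> ab nh; pose clamp (x : R) := Num.max a (Num.min x b).
apply: (eq_measurable_fun (h \o clamp)).
  move=> x /set_mem; rewrite /= in_itv/= => /andP[ax xb].
  by rewrite /clamp min_l// max_r.
apply: nondecreasing_measurable; first exact: measurable_itvR.
move=> x y xy; apply: nh.
- by rewrite le_max lexx.
- rewrite /clamp /Order.max /Order.min.
  by repeat case: ifPn; rewrite -?leNgt; move: ab xy; lra.
- by rewrite ge_max ab ge_min lexx orbT.
Qed.

Lemma nonincreasing_bounded_variation {R : realType} (a b : R) (f : R -> R) :
  (forall x y, a <= x -> x <= y -> y <= b -> f y <= f x) -> bounded_variation a b f.
Proof.
move=> nf; rewrite -[f]opprK; apply: bounded_variationN.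
apply: nondecreasing_bounded_variation => x y.
rewrite !in_itv/= => /andP[ax _] /andP[_ yb] xy.
by rewrite lerN2 nf.
Qed.

Lemma near_EFin_itvoo {R : realType} (Im Ip : \bar R) (x : R) :
  x%:E \in `]Im, Ip[ -> \forall y \near x, y%:E \in `]Im, Ip[.
Proof.
rewrite in_itv/= => /andP[Imx xIp].
have nm : \forall y \near x, (Im < y%:E)%E.
  by apply: open_nbhs_nbhs; split => //; exact: open_ereal_gt.
have np : \forall y \near x, (y%:E < Ip)%E.
  by apply: open_nbhs_nbhs; split => //; exact: open_ereal_lt.
near=> y; rewrite in_itv/=; apply/andP; split; near: y; [exact: nm|exact: np].
Unshelve. all: by end_near.
Qed.

(** * The generalized inverses and [Phi] *)

Section generalized_inverses.
Context {R : realType} (Im Ip : \bar R) (lamm lamp : \bar R -> R).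
Hypothesis lamm_noninc : forall x y, x \in `[Im, Ip] -> y \in `[Im, Ip] ->
  (x <= y)%E -> lamm y <= lamm x.
Hypothesis lamp_nondec : forall x y, x \in `[Im, Ip] -> y \in `[Im, Ip] ->
  (x <= y)%E -> lamp x <= lamp y.

Lemma le_lamm_inv W x : x \in `[Im, Ip] -> W <= lamm x ->
  (x <= lamm_inv Im Ip lamm W)%E.
Proof. by move=> xI Wx; apply: ereal_sup_ubound. Qed.

Lemma lamm_inv_le W x : x \in `[Im, Ip] -> lamm x < W ->
  (lamm_inv Im Ip lamm W <= x)%E.
Proof.
move=> xI xW; apply: ge_ereal_sup => y [yI Wy].
have [//|xy] := leP y x.
by have := lt_le_trans xW (le_trans Wy (lamm_noninc xI yI (ltW xy))); rewrite ltxx.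
Qed.

Lemma lamm_inv_antitone W1 W2 : W1 <= W2 ->
  (lamm_inv Im Ip lamm W2 <= lamm_inv Im Ip lamm W1)%E.
Proof.
move=> W12; apply: ge_ereal_sup => x [xI Wx].
by apply: le_lamm_inv => //; exact: le_trans Wx.
Qed.

Lemma lamp_inv_le W x : x \in `[Im, Ip] -> W <= lamp x ->
  (lamp_inv Im Ip lamp W <= x)%E.
Proof. by move=> xI Wx; apply: ereal_inf_lbound. Qed.

Lemma le_lamp_inv W x : x \in `[Im, Ip] -> lamp x < W ->
  (x <= lamp_inv Im Ip lamp W)%E.
Proof.
move=> xI xW; apply: le_ereal_inf_tmp => y [yI Wy].
have [//|yx] := leP x y.
by have := lt_le_trans xW (le_trans Wy (lamp_nondec yI xI (ltW yx))); rewrite ltxx.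
Qed.

Lemma lamp_inv_monotone W1 W2 : W1 <= W2 ->
  (lamp_inv Im Ip lamp W1 <= lamp_inv Im Ip lamp W2)%E.
Proof.
move=> W12; apply: le_ereal_inf_tmp => x [xI Wx].
by apply: lamp_inv_le => //; exact: le_trans Wx.
Qed.

(** If [lamm] exceeded [V] at [J], it would still do so slightly to the right, beyond the supremum.
    If it were below [V], it would already be so slightly to the left, and monotonicity would place
    the supremum there. Interiority of [J] leaves room on both sides. *)
Lemma lamm_at_inv (V J : R) : J%:E = lamm_inv Im Ip lamm V ->
  J%:E \in `]Im, Ip[ -> {for J, continuous (lamm \o EFin)} -> lamm J%:E = V.
Proof.
move=> eJ /near_EFin_itvoo nI cJ; have cJ' : lamm x%:E @[x --> J] --> lamm J%:E := cJ.
apply/eqP; rewrite eq_le !leNgt.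
apply/andP; split; apply/negP => JV.
  have : \forall x \near J, V < lamm x%:E by exact: cvgr_gt cJ' _ JV.
  move=> /(filterI nI)[d/= d0 Hd].
  have /Hd[xI Vx] : ball J d (J + d / 2).
    by rewrite /ball/= opprD addNKr normrN gtr0_norm ?divr_gt0//; lra.
  have := le_lamm_inv (subset_itv_oo_cc xI) (ltW Vx).
  by rewrite -eJ lee_fin; lra.
have : \forall x \near J, lamm x%:E < V by exact: cvgr_lt cJ' _ JV.
move=> /(filterI nI)[d/= d0 Hd].
have /Hd[xI xV] : ball J d (J - d / 2).
  by rewrite /ball/= opprB addrC subrK gtr0_norm ?divr_gt0//; lra.
have := lamm_inv_le (subset_itv_oo_cc xI) xV.
by rewrite -eJ lee_fin; lra.
Qed.

Lemma lamp_at_inv (V J : R) : J%:E = lamp_inv Im Ip lamp V ->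
  J%:E \in `]Im, Ip[ -> {for J, continuous (lamp \o EFin)} -> lamp J%:E = V.
Proof.
move=> eJ /near_EFin_itvoo nI cJ; have cJ' : lamp x%:E @[x --> J] --> lamp J%:E := cJ.
apply/eqP; rewrite eq_le !leNgt.
apply/andP; split; apply/negP => JV.
  have : \forall x \near J, V < lamp x%:E by exact: cvgr_gt cJ' _ JV.
  move=> /(filterI nI)[d/= d0 Hd].
  have /Hd[xI Vx] : ball J d (J - d / 2).
    by rewrite /ball/= opprB addrC subrK gtr0_norm ?divr_gt0//; lra.
  have := lamp_inv_le (subset_itv_oo_cc xI) (ltW Vx).
  by rewrite -eJ lee_fin; lra.
have : \forall x \near J, lamp x%:E < V by exact: cvgr_lt cJ' _ JV.
move=> /(filterI nI)[d/= d0 Hd].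
have /Hd[xI xV] : ball J d (J + d / 2).
  by rewrite /ball/= opprD addNKr normrN gtr0_norm ?divr_gt0//; lra.
have := le_lamp_inv (subset_itv_oo_cc xI) xV.
by rewrite -eJ lee_fin; lra.
Qed.

End generalized_inverses.

Lemma continuous_EFin_itv {R : realType} (Im Ip : \bar R) (lam : \bar R -> R) (x : R) :
  {within `[Im, Ip]%classic, continuous lam} -> x%:E \in `]Im, Ip[ ->
  {for x, continuous (lam \o EFin)}.
Proof.
move=> clam xI.
have sub : `]Im, Ip[%classic `<=` `[Im, Ip]%classic.
  by apply: subset_itv; rewrite bnd_simp.
have oI : open `]Im, Ip[%classic by exact: itv_open.
have := continuous_subspaceW sub clam.
rewrite continuous_open_subspace// => /(_ x%:E (mem_set xI)) c P /c.
exact.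
Qed.

Lemma eq_charge_integral {R : realType} (mu : @Charge.type _ (measurableTypeR R) R)
    (A : set (measurableTypeR R)) (f g : R -> \bar R) :
  {in A, f =1 g} -> charge_integral mu A f = charge_integral mu A g.
Proof.
by move=> fg; rewrite /charge_integral; congr (_ - _)%E; exact: eq_integral.
Qed.

(** The endpoint [a] is not an atom, so its total variation is zero. This links the closed interval
    in [Phi] with the half-open ones on which increments are measured. *)
Lemma charge_integral_itvcc {R : realType} (mu : @Charge.type _ (measurableTypeR R) R)
    (a b C : R) (h : R -> R) : a <= b -> mu [set a] = 0%E ->
  measurable_fun (`[a, b]%classic : set (measurableTypeR R)) h ->
  (forall z, a <= z -> z <= b -> `|h z| <= C) ->
  charge_integrable mu `[a, b]%classic h /\
  charge_Rintegral mu `[a, b]%classic h = charge_Rintegral mu `]a, b]%classic h.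
Proof.
move=> ab mua mh hC.
have m1 : measurable ([set a] : set (measurableTypeR R)) by exact: measurable_set1.
have hC0 (A : set R) : A `<=` `[a, b] -> forall z, A z -> `|h z - 0| <= C.
  by move=> sA z /sA; rewrite /= in_itv/= subr0 => /andP[]; exact: hC.
have [ih _] := charge_integral_oscillation mu (measurable_itvR _) mh
  (hC0 _ (@subset_refl _ _)).
split=> //; move: ih.
have sub1 : [set a] `<=` `[a, b]%classic by move=> _ ->; rewrite /= in_itv/= lexx.
have [_] := charge_integral_oscillation mu m1
  (measurable_funS (measurable_itvR _) sub1 mh) (hC0 _ sub1).
rewrite mul0r subr0 charge_var_set1// mulr0 normr_le0 => /eqP i0.
have -> : `[a, b]%classic = [set a] `|` `]a, b]%classic.
  by rewrite setU1itv// bnd_simp.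
move=> ih; rewrite charge_RintegralU ?i0 ?add0r//.
by apply/seteqP; split => // z [->]; rewrite /= in_itv/= ltxx.
Qed.

Lemma invr_nonincreasing {R : realType} (a b : R) : 0 < a ->
  forall x y, a <= x -> x <= y -> y <= b -> y^-1 <= x^-1.
Proof.
by move=> a0 x y ax xy yb; rewrite lef_pV2// posrE (lt_le_trans a0)// (le_trans ax).
Qed.

Lemma differential_inv {R : realType} (a b : R) : 0 < a -> a < b ->
  is_differential a b (fun W => W^-1) (differential a b (fun W => W^-1)).
Proof.
move=> a0 ab; apply: differentialP => //.
  apply: continuous_in_subspaceT => x /set_mem; rewrite /= in_itv/= => /andP[ax _].
  by apply: inv_continuous; rewrite gt_eqF// (lt_le_trans a0).
by apply: nonincreasing_bounded_variation; exact: invr_nonincreasing.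
Qed.

(** Both [s] and [t] have the sign of [c - V], and after substitution the last identity says that
    [c * (w - phi)] is a positive multiple of [c - V]. *)
Lemma luckock_sign {R : realFieldType} (c V u v s t w phi : R) :
  0 < c -> 0 < V -> 0 < u -> 0 < v -> s * u = c - V -> t * v = c - V ->
  c * (w - phi) = (s + t) / V ->
  [/\ phi < w -> 0 < s /\ 0 < t, phi = w -> s = 0 /\ t = 0 &
      w < phi -> s < 0 /\ t < 0].
Proof.
move=> c0 V0 u0 v0 su tv E.
have sE : s = (c - V) / u by rewrite -su mulfK ?gt_eqF.
have tE : t = (c - V) / v by rewrite -tv mulfK ?gt_eqF.
have {}E : c * (w - phi) = (c - V) * ((u^-1 + v^-1) / V).
  by rewrite E sE tE; field; rewrite ?gt_eqF.
have q0 : 0 < (u^-1 + v^-1) / V by rewrite divr_gt0// addr_gt0 ?invr_gt0.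
have ui : 0 < u^-1 by rewrite invr_gt0.
have vi : 0 < v^-1 by rewrite invr_gt0.
rewrite sE tE; split => h.
- have : 0 < c * (w - phi) by rewrite mulr_gt0 ?subr_gt0.
  by rewrite E pmulr_lgt0// => d0; rewrite !divr_gt0.
- move: E; rewrite h subrr mulr0 => /esym/eqP.
  by rewrite mulf_eq0 (gt_eqF q0) orbF => /eqP ->; rewrite !mul0r.
- have : c * (w - phi) < 0 by rewrite pmulr_rlt0// subr_lt0.
  by rewrite E pmulr_llt0// => d0; rewrite !pmulr_llt0.
Qed.

(** * The two summands of [Phi] as primitives on the two halves of [J] *)

Section half_intervals.
Context {R : realType} (Im Ip : \bar R) (lamm lamp : \bar R -> R).
Hypothesis lamm_noninc : forall x y, x \in `[Im, Ip] -> y \in `[Im, Ip] ->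
  (x <= y)%E -> lamm y <= lamm x.
Hypothesis lamp_nondec : forall x y, x \in `[Im, Ip] -> y \in `[Im, Ip] ->
  (x <= y)%E -> lamp x <= lamp y.
Hypothesis lamm_gt0 : forall x, x \in `]Im, Ip[ -> 0 < lamm x.
Hypothesis lamp_gt0 : forall x, x \in `]Im, Ip[ -> 0 < lamp x.
Variables (V Jm Jp : R).
Hypothesis hJm : Jm%:E = lamm_inv Im Ip lamm V.
Hypothesis hJp : Jp%:E = lamp_inv Im Ip lamp V.
Hypothesis JmI : Jm%:E \in `]Im, Ip[.
Hypothesis JpI : Jp%:E \in `]Im, Ip[.

Let h1 W := (lamp (lamm_inv Im Ip lamm W))^-1.
Let h2 W := (lamm (lamp_inv Im Ip lamp W))^-1.

Lemma lamm_inv_itv W : W <= V ->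
  lamm_inv Im Ip lamm W \in `[Im, Ip] /\ (Jm%:E <= lamm_inv Im Ip lamm W)%E.
Proof.
move=> WV; have JW : (Jm%:E <= lamm_inv Im Ip lamm W)%E.
  by rewrite hJm lamm_inv_antitone.
split=> //; rewrite in_itv/=; apply/andP; split.
  by apply: le_trans JW; move: JmI; rewrite in_itv/= => /andP[/ltW].
by apply: ge_ereal_sup => x []; rewrite in_itv/= => /andP[].
Qed.

Lemma lamp_inv_itv W : W <= V ->
  lamp_inv Im Ip lamp W \in `[Im, Ip] /\ (lamp_inv Im Ip lamp W <= Jp%:E)%E.
Proof.
move=> WV; have JW : (lamp_inv Im Ip lamp W <= Jp%:E)%E.
  by rewrite hJp lamp_inv_monotone.
split=> //; rewrite in_itv/=; apply/andP; split.
  by apply: le_ereal_inf_tmp => x []; rewrite in_itv/= => /andP[].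
by apply: le_trans JW _; move: JpI; rewrite in_itv/= => /andP[_ /ltW].
Qed.

Lemma lamp_lamm_inv_ge W : W <= V -> lamp Jm%:E <= lamp (lamm_inv Im Ip lamm W).
Proof.
by move=> /lamm_inv_itv[? ?]; apply: lamp_nondec => //; exact: subset_itv_oo_cc.
Qed.

Lemma lamm_lamp_inv_ge W : W <= V -> lamm Jp%:E <= lamm (lamp_inv Im Ip lamp W).
Proof.
by move=> /lamp_inv_itv[? ?]; apply: lamm_noninc => //; exact: subset_itv_oo_cc.
Qed.

Lemma lamp_lamm_inv_nondecreasing x y : x <= y -> y <= V -> h1 x <= h1 y.
Proof.
move=> xy yV; rewrite /h1 lef_pV2 ?posrE.
- apply: lamp_nondec; [exact: (lamm_inv_itv yV).1| |exact: lamm_inv_antitone].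
  exact: (lamm_inv_itv (le_trans xy yV)).1.
- exact: lt_le_trans (lamp_gt0 JmI) (lamp_lamm_inv_ge (le_trans xy yV)).
- exact: lt_le_trans (lamp_gt0 JmI) (lamp_lamm_inv_ge yV).
Qed.

Lemma lamm_lamp_inv_nondecreasing x y : x <= y -> y <= V -> h2 x <= h2 y.
Proof.
move=> xy yV; rewrite /h2 lef_pV2 ?posrE.
- apply: lamm_noninc; [|exact: (lamp_inv_itv yV).1|exact: lamp_inv_monotone].
  exact: (lamp_inv_itv (le_trans xy yV)).1.
- exact: lt_le_trans (lamm_gt0 JpI) (lamm_lamp_inv_ge (le_trans xy yV)).
- exact: lt_le_trans (lamm_gt0 JpI) (lamm_lamp_inv_ge yV).
Qed.

Lemma lamp_lamm_inv_bound W : W <= V -> `|h1 W| <= (lamp Jm%:E)^-1.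
Proof.
move=> WV; have J0 := lamp_gt0 JmI; have W0 := lt_le_trans J0 (lamp_lamm_inv_ge WV).
by rewrite ger0_norm ?invr_ge0 ?(ltW W0)// lef_pV2 ?posrE// lamp_lamm_inv_ge.
Qed.

Lemma lamm_lamp_inv_bound W : W <= V -> `|h2 W| <= (lamm Jp%:E)^-1.
Proof.
move=> WV; have J0 := lamm_gt0 JpI; have W0 := lt_le_trans J0 (lamm_lamp_inv_ge WV).
by rewrite ger0_norm ?invr_ge0 ?(ltW W0)// lef_pV2 ?posrE// lamm_lamp_inv_ge.
Qed.

(** For [W <= V] the inverses stay to the right of [Jm] and to the left of [Jp] respectively, so the
    denominators are bounded away from 0. Hence the extended inverses are real, the integrand is
    bounded and [Phi V] is finite. *)
Lemma PhiE (a := VW Im Ip lamm lamp)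
    (mu := differential a V (fun W => W^-1)) : 0 < a -> a < V ->
  Phi Im Ip lamm lamp V =
    (- (charge_Rintegral mu `]a, V]%classic h1 +
        charge_Rintegral mu `]a, V]%classic h2))%:E.
Proof.
move=> a0 aV; have [mua _ _] := differential_inv a0 aV.
have [i1 E1] := charge_integral_itvcc (ltW aV) (mua a)
  (nondecreasing_itv_measurable (ltW aV)
    (fun x y _ xy yV => lamp_lamm_inv_nondecreasing xy yV))
  (fun W _ WV => lamp_lamm_inv_bound WV).
have [i2 E2] := charge_integral_itvcc (ltW aV) (mua a)
  (nondecreasing_itv_measurable (ltW aV)
    (fun x y _ xy yV => lamm_lamp_inv_nondecreasing xy yV))
  (fun W _ WV => lamm_lamp_inv_bound WV).
have [i12 E12] := charge_RintegralD (measurable_itvR _) i1 i2.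
rewrite /Phi EFinN -E1 -E2 -E12 -charge_integralE//.
congr (- _)%E; apply: eq_charge_integral => W /set_mem.
rewrite /= in_itv/= => /andP[_ WV].
have p1 := lt_le_trans (lamp_gt0 JmI) (lamp_lamm_inv_ge WV).
have p2 := lt_le_trans (lamm_gt0 JpI) (lamm_lamp_inv_ge WV).
by rewrite !inver !gt_eqF.
Qed.

(** The substitution [W = lamm x] is applied on [[Jm, z]]. The integral runs over all of []a, V]] at
    [t = Jm] and over an empty interval at [t = z]. *)
Lemma Phi_left_negl (a z : R) (mu := differential a V (fun W => W^-1)) :
  0 < a -> a < V -> Jm <= z -> z%:E \in `]Im, Ip[ ->
  lamm Jm%:E = V -> lamm z%:E = a ->
  (forall x, Jm <= x -> x <= z -> {for x, continuous (lamp \o EFin)}) ->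
  negl Jm z (fun x y =>
    delta (fun t => - charge_Rintegral mu `]a, lamm t%:E]%classic h1) x y
    + (lamp x%:E)^-1 * delta (fun t => (lamm t%:E)^-1) x y).
Proof.
move=> a0 aV Jz zI lJ lz clp.
have tI t : Jm <= t -> t <= z -> t%:E \in `]Im, Ip[.
  move: JmI zI; rewrite !in_itv/= => /andP[ImJ _] /andP[_ zIp] Jt tz.
  by rewrite (lt_le_trans ImJ) ?lee_fin// (le_lt_trans _ zIp) ?lee_fin.
have tI' t : Jm <= t -> t <= z -> t%:E \in `[Im, Ip].
  by move=> Jt tz; apply: subset_itv_oo_cc; exact: tI.
have lmon x y : Jm <= x -> x <= y -> y <= z -> lamm y%:E <= lamm x%:E.
  move=> Jx xy yz; apply: lamm_noninc; rewrite ?lee_fin//; apply: tI' => //.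
    exact: le_trans yz.
  exact: le_trans xy.
have lab x : Jm <= x -> x <= z -> a <= lamm x%:E /\ lamm x%:E <= V.
  by move=> Jx xz; rewrite -lz -lJ !lmon.
have vk : vanishing Jm z (delta (fun x => (lamp x%:E)^-1)).
  apply: vanishing_delta; apply: continuous_in_subspaceT => x /set_mem.
  rewrite /= in_itv/= => /andP[Jx xz].
  by apply: cvgV; [rewrite gt_eqF// lamp_gt0// tI|exact: clp].
have mh : measurable_fun (`[a, V]%classic : set (measurableTypeR R)) h1.
  apply: nondecreasing_itv_measurable => [|x y _]; first exact: ltW.
  exact: lamp_lamm_inv_nondecreasing.
have := differential_primitive_negl
  (differential_inv a0 aV) mh
  (fun W _ WV => lamp_lamm_inv_bound WV) vk lab (or_introl lmon).
case/(_ _)/wrap.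
  (* [lamm_inv W] lies between [x] and [y] for [lamm y < W <= lamm x] *)
  move=> x y Jx xy yz W; rewrite min_r ?max_l ?lmon// => yW Wx.
  have xW := le_lamm_inv (tI' x Jx (le_trans xy yz)) Wx.
  have Wy := lamm_inv_le lamm_noninc (tI' y (le_trans Jx xy) yz) yW.
  have wfin : (lamm_inv Im Ip lamm W) \is a fin_num.
    by rewrite fin_numE; apply/andP; split; apply/eqP => e; move: xW Wy; rewrite e.
  exists (fine (lamm_inv Im Ip lamm W)); last by rewrite /h1 fineK.
  by rewrite -!lee_fin fineK// xW Wy.
move=> n; have b1 : bounded2 Jm z (fun _ _ => -1) by exists 1 => *; rewrite normrN1.
by apply: eq_negl (neglM b1 n) => x y _ _ _; rewrite /delta; ring.
Qed.

(** The mirror image, with [W = lamp x] increasing from [a] at [z] to [V] at [Jp]. *)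
Lemma Phi_right_negl (a z : R) (mu := differential a V (fun W => W^-1)) :
  0 < a -> a < V -> z <= Jp -> z%:E \in `]Im, Ip[ ->
  lamp Jp%:E = V -> lamp z%:E = a ->
  (forall x, z <= x -> x <= Jp -> {for x, continuous (lamm \o EFin)}) ->
  negl z Jp (fun x y =>
    delta (fun t => - charge_Rintegral mu `]a, lamp t%:E]%classic h2) x y
    + (lamm x%:E)^-1 * delta (fun t => (lamp t%:E)^-1) x y).
Proof.
move=> a0 aV zJ zI lJ lz clm.
have tI t : z <= t -> t <= Jp -> t%:E \in `]Im, Ip[.
  move: JpI zI; rewrite !in_itv/= => /andP[_ JIp] /andP[Imz _] zt tJ.
  by rewrite (lt_le_trans Imz) ?lee_fin// (le_lt_trans _ JIp) ?lee_fin.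
have tI' t : z <= t -> t <= Jp -> t%:E \in `[Im, Ip].
  by move=> zt tJ; apply: subset_itv_oo_cc; exact: tI.
have lmon x y : z <= x -> x <= y -> y <= Jp -> lamp x%:E <= lamp y%:E.
  move=> zx xy yJ; apply: lamp_nondec; rewrite ?lee_fin//; apply: tI' => //.
    exact: le_trans yJ.
  exact: le_trans xy.
have lab x : z <= x -> x <= Jp -> a <= lamp x%:E /\ lamp x%:E <= V.
  by move=> zx xJ; rewrite -lz -lJ !lmon.
have vk : vanishing z Jp (delta (fun x => (lamm x%:E)^-1)).
  apply: vanishing_delta; apply: continuous_in_subspaceT => x /set_mem.
  rewrite /= in_itv/= => /andP[zx xJ].
  by apply: cvgV; [rewrite gt_eqF// lamm_gt0// tI|exact: clm].
have mh : measurable_fun (`[a, V]%classic : set (measurableTypeR R)) h2.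
  apply: nondecreasing_itv_measurable => [|x y _]; first exact: ltW.
  exact: lamm_lamp_inv_nondecreasing.
have := differential_primitive_negl
  (differential_inv a0 aV) mh
  (fun W _ WV => lamm_lamp_inv_bound WV) vk lab (or_intror lmon).
case/(_ _)/wrap.
  move=> x y zx xy yJ W; rewrite min_l ?max_r ?lmon// => xW Wy.
  have wy := lamp_inv_le (tI' y (le_trans zx xy) yJ) Wy.
  have xw := le_lamp_inv lamp_nondec (tI' x zx (le_trans xy yJ)) xW.
  have wfin : (lamp_inv Im Ip lamp W) \is a fin_num.
    by rewrite fin_numE; apply/andP; split; apply/eqP => e; move: xw wy; rewrite e.
  exists (fine (lamp_inv Im Ip lamp W)); last by rewrite /h2 fineK.
  by rewrite -!lee_fin fineK// xw wy.
move=> n; have b1 : bounded2 z Jp (fun _ _ => -1) by exists 1 => *; rewrite normrN1.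
by apply: eq_negl (neglM b1 n) => x y _ _ _; rewrite /delta; ring.
Qed.

End half_intervals.

(** * The crossing level, and the signs at the ends of [J] *)

Lemma VW_upper_bound {R : realType} (Im Ip : \bar R) (lamm lamp : \bar R -> R) :
  (Im <= Ip)%E ->
  (forall x y, x \in `[Im, Ip] -> y \in `[Im, Ip] -> (x <= y)%E -> lamm y <= lamm x) ->
  forall x, x \in `[Im, Ip] -> Num.min (lamm x) (lamp x) <= VW Im Ip lamm lamp.
Proof.
move=> II lamm_noninc x xI; apply: sup_upper_bound; last by exists x.
split; first by exists (Num.min (lamm x) (lamp x)), x.
(* A real supremum is an upper bound only for a bounded set; the largest value of [lamm] provides
   the bound. *)
exists (lamm Im) => _ [y yI <-]; rewrite ge_min lamm_noninc//.
- by rewrite in_itv/= lexx.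
- by move: yI; rewrite /= in_itv/= => /andP[].
Qed.

(** To the right of [z] the minimum is at most [lamm z], to the left at most [lamp z], so it is
    largest at the crossing. *)
Lemma VW_crossing {R : realType} (Im Ip : \bar R) (lamm lamp : \bar R -> R) z :
  (forall x y, x \in `[Im, Ip] -> y \in `[Im, Ip] -> (x <= y)%E -> lamm y <= lamm x) ->
  (forall x y, x \in `[Im, Ip] -> y \in `[Im, Ip] -> (x <= y)%E -> lamp x <= lamp y) ->
  z \in `[Im, Ip] -> lamm z = lamp z -> VW Im Ip lamm lamp = lamm z.
Proof.
move=> lamm_noninc lamp_nondec zI e; apply/eqP; rewrite eq_le; apply/andP; split.
  apply: ge_sup; first by exists (Num.min (lamm z) (lamp z)), z.
  move=> _ [x xI <-]; rewrite ge_min.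
  have [zx|/ltW xz] := leP z x; first by rewrite lamm_noninc.
  by rewrite e (lamp_nondec x z) ?orbT.
have := VW_upper_bound lamp _ lamm_noninc zI.
rewrite -e minxx; apply.
by move: zI; rewrite in_itv/= => /andP[]; exact: le_trans.
Qed.

Unset Implicit Arguments.

Theorem proposition5 (R : realType) (Im Ip : \bar R) (lamm lamp : \bar R -> R)
  (hI : (Im < Ip)%E)
  (lamm_cont : {within `[Im, Ip]%classic, continuous lamm})
  (lamp_cont : {within `[Im, Ip]%classic, continuous lamp})
  (lamm_ge0 : forall x, x \in `[Im, Ip] -> 0 <= lamm x)
  (lamp_ge0 : forall x, x \in `[Im, Ip] -> 0 <= lamp x)
  (lamm_noninc : forall x y, x \in `[Im, Ip] -> y \in `[Im, Ip] ->
     (x <= y)%E -> lamm y <= lamm x)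
  (lamp_nondec : forall x y, x \in `[Im, Ip] -> y \in `[Im, Ip] ->
     (x <= y)%E -> lamp x <= lamp y)
  (lamm_gt0 : forall x, x \in `]Im, Ip[ -> 0 < lamm x)
  (lamp_gt0 : forall x, x \in `]Im, Ip[ -> 0 < lamp x)
  (VW_lt_Vmax : VW Im Ip lamm lamp < Vmax Im Ip lamm lamp)
  (V : R) (V_gt : VW Im Ip lamm lamp < V) (V_le : V <= Vmax Im Ip lamm lamp)
  (Jm Jp : R)
  (hJm : Jm%:E = lamm_inv Im Ip lamm V) (hJp : Jp%:E = lamp_inv Im Ip lamp V)
  (hJ : `[Jm%:E, Jp%:E]%classic `<=` `]Im, Ip[%classic)
  (fm fp : R -> R)
  (hf : luckock_solution Jm Jp (lamm \o EFin) (lamp \o EFin) fm fp) :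
  [/\ (Phi Im Ip lamm lamp V < ((VW Im Ip lamm lamp) ^- 2)%:E)%E ->
        0 < fm Jm /\ 0 < fp Jp,
      Phi Im Ip lamm lamp V = ((VW Im Ip lamm lamp) ^- 2)%:E ->
        fm Jm = 0 /\ fp Jp = 0
    & (((VW Im Ip lamm lamp) ^- 2)%:E < Phi Im Ip lamm lamp V)%E ->
        fm Jm < 0 /\ fp Jp < 0].
Proof.
have VWub := VW_upper_bound lamp (ltW hI) lamm_noninc.
(* If [y < x] with [lamp y] and [lamm x] both at least [V], then [lamm y] is at least [V] too, so
   the minimum at [y] would exceed [VW]. *)
have JmJp : Jm <= Jp.
  rewrite -lee_fin hJm hJp; apply: ge_ereal_sup => x [xI Vx].
  apply: le_ereal_inf_tmp => y [yI Vy]; rewrite leNgt; apply/negP => yx.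
  have := le_lt_trans (VWub _ yI) V_gt; rewrite ltNge le_min Vy andbT.
  by rewrite (le_trans Vx)// lamm_noninc// ltW.
have JI x : Jm <= x -> x <= Jp -> x%:E \in `]Im, Ip[.
  by move=> Jx xJ; apply: hJ; rewrite /= in_itv/= !lee_fin Jx.
have JI' x : Jm <= x -> x <= Jp -> x%:E \in `[Im, Ip].
  by move=> Jx xJ; apply: subset_itv_oo_cc; exact: JI.
have JmI := JI _ (lexx _) JmJp; have JpI := JI _ JmJp (lexx _).
have clm x : Jm <= x -> x <= Jp -> {for x, continuous (lamm \o EFin)}.
  by move=> Jx xJ; apply: continuous_EFin_itv lamm_cont _; exact: JI.
have clp x : Jm <= x -> x <= Jp -> {for x, continuous (lamp \o EFin)}.
  by move=> Jx xJ; apply: continuous_EFin_itv lamp_cont _; exact: JI.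
have lmJm : lamm Jm%:E = V by apply: (lamm_at_inv lamm_noninc hJm JmI); exact: clm.
have lpJp : lamp Jp%:E = V by apply: (lamp_at_inv lamp_nondec hJp JpI); exact: clp.
have lpJm : lamp Jm%:E < V.
  have := le_lt_trans (VWub _ (subset_itv_oo_cc JmI)) V_gt.
  by rewrite lmJm gt_min ltxx.
have lmJp : lamm Jp%:E < V.
  have := le_lt_trans (VWub _ (subset_itv_oo_cc JpI)) V_gt.
  by rewrite lpJp gt_min ltxx orbF.
have {}JmJp : Jm < Jp.
  by rewrite lt_neqAle JmJp andbT; apply/eqP => e; move: lpJm; rewrite e lpJp ltxx.
have within f : (forall x, Jm <= x -> x <= Jp -> {for x, continuous f}) ->
    {within `[Jm, Jp], continuous (f : R -> R)}.
  move=> cf; apply: continuous_in_subspaceT => x /set_mem.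
  by rewrite /= in_itv/= => /andP[]; exact: cf.
have wlm := within _ clm; have wlp := within _ clp.
(* The difference [lamm - lamp] is positive at [Jm] and negative at [Jp]. *)
have [z /andP[Jz zJ] lz] : exists2 z, Jm <= z <= Jp & lamm z%:E = lamp z%:E.
  have [||z zJ /eqP e] := @IVT R (fun x => lamm x%:E - lamp x%:E) _ _ 0 (ltW JmJp).
  - by apply: within => x Jx xJ; apply: cvgB; [exact: clm|exact: clp].
  - by rewrite lmJm lpJp ge_min le_max !subr_ge0 !subr_le0 (ltW lpJm) (ltW lmJp) orbT.
  by exists z => //; apply/eqP; rewrite -subr_eq0.
have VWz := VW_crossing lamm_noninc lamp_nondec (JI' _ Jz zJ) lz.
set a := VW Im Ip lamm lamp in V_gt VWz *.
have a0 : 0 < a by rewrite VWz; exact/lamm_gt0/JI.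
have V0 : 0 < V by exact: lt_trans V_gt.
rewrite (PhiE lamm_noninc lamp_nondec lamm_gt0 lamp_gt0
  hJm hJp JmI JpI a0 V_gt) -/a.
set mu := differential _ _ _.
set h1 := fun W => (lamp _)^-1; set h2 := fun W => (lamm _)^-1.
have [[cfm bvm] [cfp bvp] eq1 eq2 [fmJp fpJm]] := hf.
pose lm x := lamm x%:E; pose lp x := lamp x%:E.
have mlm x y : Jm <= x -> x <= y -> y <= Jp -> lm y <= lm x.
  move=> Jx xy yJ; apply: lamm_noninc; rewrite ?lee_fin//; apply: JI' => //.
    exact: le_trans yJ.
  exact: le_trans xy.
have mlp x y : Jm <= x -> x <= y -> y <= Jp -> lp x <= lp y.
  move=> Jx xy yJ; apply: lamp_nondec; rewrite ?lee_fin//; apply: JI' => //.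
    exact: le_trans yJ.
  exact: le_trans xy.
have dlm := differentialP JmJp wlm (nonincreasing_bounded_variation mlm).
have bvlp : bounded_variation Jm Jp lp.
  apply: nondecreasing_bounded_variation => x y; rewrite !in_itv/=.
  by move=> /andP[Jx _] /andP[_ yJ] xy; exact: mlp.
have dlp := differentialP JmJp wlp bvlp.
have dfm := differentialP JmJp cfm bvm.
have dfp := differentialP JmJp cfp bvp.
have n12 := differential_equation_negl cfm wlm dlp dfp eq1.
have n21 := differential_equation_negl cfp wlp dlm dfm eq2.
have cE := luckock_invariant (vanishing_delta cfm)
  (vanishing_delta cfp) (differential_var_dominated dlm)
  (differential_var_dominated dlp) n12 n21.
set c := _ + _ in cE.
have cE' x : Jm <= x -> x <= Jp -> fp x * lm x + fm x * lp x = c.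
  by move=> Jx xJ; rewrite addrC; exact: cE.
(* By monotonicity [lp] is smallest at [Jm] and [lm] at [Jp], so [w] bounds both from below on
   [J]. *)
pose w := Num.min (lp Jm) (lm Jp).
have w0 : 0 < w by rewrite lt_min lamp_gt0// lamm_gt0.
have wl x : Jm <= x -> x <= Jp -> w <= lm x /\ w <= lp x.
  by move=> Jx xJ; rewrite !ge_min mlm ?mlp// orbT.
have wl' x : Jm <= x -> x <= Jp -> w <= lp x /\ w <= lm x.
  by move=> Jx xJ; have [] := wl x Jx xJ.
have left := luckock_quotient_primitive Jz w0
  (fun x Jx xz => wl x Jx (le_trans xz zJ))
  (fun x Jx xz => cE x Jx (le_trans xz zJ))
  (neglS (lexx _) zJ n21)
  (Phi_left_negl lamm_noninc lamp_nondec lamp_gt0 hJm JmI a0 V_gt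
    Jz (JI _ Jz zJ) lmJm (esym VWz) (fun x Jx xz => clp x Jx (le_trans xz zJ))).
(* The same lemma with the signs exchanged: [fp / lamp] is the quotient, and the other equation is
   used. *)
have right := luckock_quotient_primitive zJ w0
  (fun x zx xJ => wl' x (le_trans Jz zx) xJ)
  (fun x zx xJ => cE' x (le_trans Jz zx) xJ)
  (neglS Jz (lexx _) n12)
  (Phi_right_negl lamm_noninc lamp_nondec lamm_gt0 hJp JpI a0 V_gt
    zJ (JI _ Jz zJ) lpJp (etrans (esym lz) (esym VWz))
    (fun x zx xJ => clm x (le_trans Jz zx) xJ)).
(* Both primitives vanish at [z], where the level is [a]. *)
have int0 h : charge_Rintegral mu `]a, a]%classic h = 0.
  by rewrite set_itv_ge ?bnd_simp ?ltxx// /charge_Rintegral !Rintegral_set0 subrr.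
move: left right; rewrite /lm /lp -lz -VWz lmJm lpJp !int0 -/h1 -/h2.
set i1 := charge_Rintegral mu _ h1; set i2 := charge_Rintegral mu _ h2 => left right.
(* The invariant is evaluated at each end of [J], where one product equals [V] by the boundary
   condition. *)
have cJm : fm Jm * lamp Jm%:E = c - V by rewrite /c/= fpJm mul1r lmJm addrK.
have cJp : fp Jp * lamm Jp%:E = c - V.
  by rewrite -(cE' Jp (ltW JmJp) (lexx _)) fmJp mul1r /lp lpJp addrK.
have cz : fp z * a + fm z * a = c.
  by have := cE' z Jz zJ; rewrite /lm /lp -lz -VWz.
have c0 : 0 < c.
  rewrite ltNge; apply/negP => c0.
  have := luckock_quotient_nonincreasing (ltW JmJp) w0 wl mlm cE n21 c0.
  rewrite /lm fmJp lmJm leNgt => /negP; apply.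
  rewrite (@lt_trans _ _ 0)//; last by rewrite divr_gt0 ?lamm_gt0.
  rewrite pmulr_llt0 ?invr_gt0// -(pmulr_llt0 _ (lamp_gt0 _ JmI)) cJm.
  by rewrite subr_lt0 (le_lt_trans c0).
have E : c * (a ^- 2 - - (i1 + i2)) = (fm Jm + fp Jp) / V.
  (* At [z] both weights equal [a], so the invariant turns the sum of the two boundary terms at [z]
     into [c * a ^- 2]. *)
  have ca : c * a ^- 2 = (fp z + fm z) / a by rewrite -cz; field; rewrite gt_eqF.
  by move: left right; rewrite opprK mulrDr ca !mulrDl; lra.
have [s1 s2 s3] := luckock_sign c0 V0 (lamp_gt0 _ JmI)
  (lamm_gt0 _ JpI) cJm cJp E.
by rewrite !lte_fin; split => // -[]; exact: s2.
Qed.
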